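(* Let $(\Omega,\mu)$ be a measure space with $\mu$ a continuous measure (i.e., without point masses). I. There exists a sequence $(v_n)_{n\ge1}$ in $L^2_{\mathbb R}(\Omega,\mu)$ such that (1) $v_n\ge 0$ on $\Omega$ for all $n$; (2) $\sum_n v_n(x)^2=\infty$ on $\Omega$; (3) there is $B>0$ such that $0<\sum_n|(f,v_n)|^2\le B\|f\|^2$ for every $f\in L^2_{\mathbb R}(\Omega,\mu)$, $f\neq0$ (i.e., $(v_n)$ is a complete Bessel sequence). II. There exist a subset $E\subset\Omega$ with $0<\mu E<\infty$ and an orthonormal basis $(u_k)_{k\ge1}$ of $L^2_{\mathbb R}(\Omega,\mu)$ such that the functions $v_n:=u_{2n}|_E$, $n=1,2,\dots$, satisfy conditions (1)–(3) of part I with $\Omega$ replaced by $E$ (and $L^2_{\mathbb R}(\Omega,\mu)$ replaced by $L^2_{\mathbb R}(E,\mu)$).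
   Context: $L^2_{\mathbb R}(\Omega,\mu)$ denotes the real Lebesgue space with inner product $(f,g)=\int_\Omega fg\,d\mu$.
   Formalization: The formal theorem also assumes that L²(Ω,μ) is separable and μ(Ω)>0, and reads ''continuous'' as: every set of positive measure has a subset of strictly smaller positive measure; the claim fails without these. Conditions (1) and (2) hold almost everywhere. *)

(* Defs.v *)
From HB Require Import structures.
From mathcomp Require Import all_boot all_order all_algebra.
From mathcomp Require Import all_classical all_reals all_analysis.
Set Implicit Arguments. Unset Strict Implicit. Unset Printing Implicit Defensive.
Import Order.TTheory GRing.Theory Num.Theory.
Import numFieldNormedType.Exports.
Local Open Scope classical_set_scope.
Local Open Scope ring_scope.

(* L^2_R(D, mu) for a measurable D is represented by
   its square-integrable measurable real functions on D; equality in L^2 is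
   equality mu-a.e. on D. *)
Section L2defs.
Context {d : measure_display} {T : measurableType d} {R : realType}
  (mu : {measure set T -> \bar R}).

Definition L2 (D : set T) (f : T -> R) : Prop :=
  measurable_fun D f /\ (\int[mu]_(x in D) ((f x) ^+ 2)%:E < +oo)%E.

Definition ip (D : set T) (f g : T -> R) : R :=
  Rintegral mu D (fun x => f x * g x).

Definition sqnorm (D : set T) (f : T -> R) : R := ip D f f.

Definition null_on (D : set T) (f : T -> R) : Prop :=
  {ae mu, forall x, D x -> f x = 0}.

Definition bessel_sum (D : set T) (f : T -> R) (v : nat -> T -> R) : \bar R :=
  (\sum_(0 <= n <oo) ((ip D f (v n)) ^+ 2)%:E)%E.

Definition complete_bessel (D : set T) (v : nat -> T -> R) : Prop :=
  (forall n, L2 D (v n)) /\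
  (forall n, {ae mu, forall x, D x -> 0 <= v n x}) /\
  {ae mu, forall x, D x -> (\sum_(0 <= n <oo) ((v n x) ^+ 2)%:E)%E = +oo%E} /\
  exists B : R, 0 < B /\
    forall f, L2 D f -> ~ null_on D f ->
      (0 < bessel_sum D f v)%E /\ (bessel_sum D f v <= (B * sqnorm D f)%:E)%E.

(* orthonormal basis of L^2_R(Omega, mu), indexed by nat (k = 0,1,2,...
   corresponds to k = 1,2,3,... in the paper) *)
Definition orthonormal_basis (u : nat -> T -> R) : Prop :=
  (forall k, L2 setT (u k)) /\
  (forall j k, ip setT (u j) (u k) = (j == k)%:R) /\
  (forall f, L2 setT f -> (forall k, ip setT f (u k) = 0) -> null_on setT f).

Definition atomless : Prop :=
  forall A, measurable A -> (0 < mu A)%E ->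
    exists B, [/\ measurable B, B `<=` A & (0 < mu B < mu A)%E].

Definition L2_separable : Prop :=
  exists g : nat -> T -> R, (forall k, L2 setT (g k)) /\
    forall f, L2 setT f -> forall e : R, 0 < e ->
      exists k, sqnorm setT (f \- g k) < e.

End L2defs.

(* Main.v *)
Require Import Defs.
From HB Require Import structures.
From mathcomp Require Import all_boot all_order all_algebra.
From mathcomp Require Import all_classical all_reals all_analysis.
From mathcomp Require Import measurable_realfun ring lra.
Import Order.TTheory GRing.Theory Num.Theory.
Import numFieldNormedType.Exports.
Local Open Scope classical_set_scope.
Local Open Scope ring_scope.
Set Implicit Arguments.
Unset Strict Implicit.

(* Part I. Atomlessness and separability give, for each m, a partition (A_{m,n})_n
   of Omega up to a null set into sets of measure at most 2^-(m+4). By Bessel's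
   inequality for disjoint indicators, sum_n (f, 1_{A_{m,n}})^2 <= 2^-(m+4) |f|^2,
   so all these indicators together form a Bessel sequence, while every m
   contributes 1 to the sum of squares at almost every point. Completeness comes
   from adding small multiples of the positive and negative parts of a dense
   sequence.

   Part II. The Bessel bound obtained is at most 1; restrict the sequence
   to E. Its Gram matrix G then satisfies G <= I, so a Cholesky
   factorization I - G = L L^T provides functions w_n outside E, finite
   combinations of orthonormal e_0, e_2, e_4, ... supported there, with
   (w_i, w_j) = delta_ij - G_ij: the functions v_n + w_n are orthonormal. The
   unused e_1, e_3, ... keep the orthogonal complement infinite dimensional, so
   its orthonormal basis is a sequence that can be put at the even indices. *)

(** * Inner product calculus on square-integrable functions *)

Section InnerProduct.
Context (d : measure_display) (T : measurableType d) (R : realType)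
  (mu : {measure set T -> \bar R}).
Implicit Types f g h : T -> R.

Local Notation L2T := (L2 mu setT).
Local Notation ipT := (ip mu setT).

Lemma L2P f : L2T f <-> measurable_fun setT f /\
  mu.-integrable setT (EFin \o (fun x => f x * f x)).
Proof.
have E : (\int[mu]_(x in setT) `|(EFin \o (fun x => (f x * f x)%R)) x| =
          \int[mu]_(x in setT) ((f x) ^+ 2)%:E)%E.
  by apply: eq_integral => x _ /=; rewrite ger0_norm ?expr2// -expr2 sqr_ge0.
split=> -[mf If]; split => //; last by move/integrableP : If => [_]; rewrite E.
apply/integrableP; split; last by rewrite E.
by apply/measurable_EFinP; exact: measurable_funM.
Qed.

Lemma L2_integrableM f g : L2T f -> L2T g ->
  mu.-integrable setT (EFin \o (fun x => f x * g x)).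
Proof.
move=> /L2P[mf If] /L2P[mg Ig].
have Ifg := integrableD measurableT If Ig.
apply: (le_integrable measurableT _ _ Ifg) => [|x _ /=].
  by apply/measurable_EFinP; exact: measurable_funM.
rewrite lee_fin [leRHS]ger0_norm ?addr_ge0 -?expr2 ?sqr_ge0// ler_norml.
have := sqr_ge0 (f x + g x); have := sqr_ge0 (f x - g x).
have := sqr_ge0 (f x); have := sqr_ge0 (g x).
by move=> *; apply/andP; split; nra.
Qed.

Lemma L2D f g : L2T f -> L2T g -> L2T (fun x => f x + g x).
Proof.
move=> Lf Lg; apply/L2P; split.
  by apply: measurable_funD; [case: Lf|case: Lg].
have I := integrableD measurableT
  (integrableD measurableT (L2_integrableM Lf Lf) (L2_integrableM Lg Lg))
  (integrableZl measurableT 2 (L2_integrableM Lf Lg)).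
apply: eq_integrable I => // x _ /=; rewrite -EFinM -!EFinD.
by congr EFin; ring.
Qed.

Lemma L2Z c f : L2T f -> L2T (fun x => c * f x).
Proof.
move=> Lf; apply/L2P; split.
  by apply: measurable_funM => //; case: Lf.
have I := integrableZl measurableT (c ^+ 2) (L2_integrableM Lf Lf).
apply: eq_integrable I => // x _ /=; rewrite -EFinM.
by congr EFin; ring.
Qed.

Lemma L2_sum (I : Type) (s : seq I) (P : pred I) (c : I -> R) (w : I -> T -> R) :
  (forall i, L2T (w i)) -> L2T (fun x => \sum_(i <- s | P i) c i * w i x).
Proof.
move=> Lw; elim: s => [|i s IH].
  have -> : (fun x => \sum_(i <- [::] | P i) c i * w i x) = cst 0.
    by apply/funext => x; rewrite big_nil.
  apply/L2P; split => //; apply: eq_integrable (integrable0 _ _) => //.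
  by move=> x _ /=; rewrite mulr0.
have -> : (fun x => \sum_(j <- i :: s | P j) c j * w j x) =
  if P i then (fun x => c i * w i x + \sum_(j <- s | P j) c j * w j x)
  else (fun x => \sum_(j <- s | P j) c j * w j x).
  by apply/funext => x; rewrite big_cons; case: ifP.
by case: ifP => // _; apply: L2D => //; exact: L2Z.
Qed.

Lemma le_L2 f g : measurable_fun setT f -> (forall x, `|f x| <= `|g x|) ->
  L2T g -> L2T f.
Proof.
move=> mf fg /L2P[mg Ig]; apply/L2P; split => //.
apply: (le_integrable measurableT _ _ Ig) => [|x _ /=].
  by apply/measurable_EFinP; exact: measurable_funM.
by rewrite lee_fin !normrM; exact: ler_pM.
Qed.

Lemma ipC f g : ipT f g = ipT g f.
Proof. by apply: eq_Rintegral => x _; rewrite mulrC. Qed.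

Lemma ipDl f g h : L2T f -> L2T g -> L2T h ->
  ipT (fun x => f x + g x) h = ipT f h + ipT g h.
Proof.
move=> Lf Lg Lh; rewrite /ip -RintegralD//; try exact: L2_integrableM.
by apply: eq_Rintegral => x _; rewrite mulrDl.
Qed.

Lemma ipZl c f h : L2T f -> L2T h -> ipT (fun x => c * f x) h = c * ipT f h.
Proof.
move=> Lf Lh; rewrite /ip -RintegralZl//; try exact: L2_integrableM.
by apply: eq_Rintegral => x _; rewrite mulrA.
Qed.

Lemma ipDr f g h : L2T f -> L2T g -> L2T h ->
  ipT h (fun x => f x + g x) = ipT h f + ipT h g.
Proof. by move=> *; rewrite ipC ipDl// !(ipC h). Qed.

Lemma ipZr c f h : L2T f -> L2T h -> ipT h (fun x => c * f x) = c * ipT h f.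
Proof. by move=> *; rewrite ipC ipZl// (ipC h). Qed.

Lemma ip_suml (I : Type) (s : seq I) (P : pred I) (c : I -> R) (w : I -> T -> R) h :
  (forall i, L2T (w i)) -> L2T h ->
  ipT (fun x => \sum_(i <- s | P i) c i * w i x) h =
  \sum_(i <- s | P i) c i * ipT (w i) h.
Proof.
move=> Lw Lh; elim: s => [|i s IH].
  rewrite big_nil -[RHS](mul0r (ipT h h)) -ipZl//.
  by rewrite /ip; apply: eq_Rintegral => x _; rewrite big_nil !mul0r.
rewrite big_cons; have -> : (fun x => \sum_(j <- i :: s | P j) c j * w j x) =
  if P i then (fun x => c i * w i x + \sum_(j <- s | P j) c j * w j x)
  else (fun x => \sum_(j <- s | P j) c j * w j x).
  by apply/funext => x; rewrite big_cons; case: ifP.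
by case: ifP => // _; rewrite ipDl// ?ipZl ?IH//; [exact: L2Z|exact: L2_sum].
Qed.

Lemma ip_sumr (I : Type) (s : seq I) (P : pred I) (c : I -> R) (w : I -> T -> R) h :
  (forall i, L2T (w i)) -> L2T h ->
  ipT h (fun x => \sum_(i <- s | P i) c i * w i x) =
  \sum_(i <- s | P i) c i * ipT h (w i).
Proof.
move=> Lw Lh; rewrite ipC ip_suml//.
by apply: eq_bigr => i _; rewrite ipC.
Qed.

Lemma ip_ge0 f : 0 <= ipT f f.
Proof. by apply: Rintegral_ge0 => x _; rewrite -expr2 sqr_ge0. Qed.

Lemma ip_eq0_null f : L2T f -> ipT f f = 0 -> null_on mu setT f.
Proof.
move=> Lf; have If := L2_integrableM Lf Lf.
rewrite /ip /Rintegral => I0.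
have {}I0 : (\int[mu]_(x in setT) (f x * f x)%:E = 0)%E.
  by rewrite -[LHS]fineK ?I0//; exact: integrable_fin_num If.
have /ae_eq_integral_abs : measurable_fun setT (EFin \o (fun x => f x * f x)).
  exact: measurable_int If.
move=> /(_ mu measurableT)[+ _] => /(_ _)[|N [mN N0 sN]].
  rewrite -[RHS]I0; apply: eq_integral => x _ /=.
  by rewrite ger0_norm// -expr2 sqr_ge0.
exists N; split => //; apply: subset_trans sN => x /= + H; apply => _.
by have /= [/eqP] := H I; rewrite mulf_eq0 orbb => /eqP.
Qed.

(** The polynomial [Q], the squared norm of [f + t g], is nonnegative in [t]. Evaluate it at its
    minimizer when [g] has positive norm; otherwise it is affine, so its slope must vanish. *)
Lemma cauchy_schwarz f g : L2T f -> L2T g ->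
  (ipT f g) ^+ 2 <= ipT f f * ipT g g.
Proof.
move=> Lf Lg.
have Q t : 0 <= ipT f f + 2 * t * ipT f g + t ^+ 2 * ipT g g.
  have := ip_ge0 (fun x => f x + t * g x).
  rewrite ipDl ?ipDr ?ipZl ?ipZr//; try (by apply: L2Z); last first.
    by apply: L2D => //; exact: L2Z.
  rewrite (ipC g f) => /le_trans; apply; lra.
have [g0|g0] := eqVneq (ipT g g) 0.
  rewrite g0 in Q *.
  have [->|fg0] := eqVneq (ipT f g) 0; first by rewrite expr0n mulr0.
  (* At this [t] the affine polynomial takes the value -1. *)
  have := Q (- (1 + ipT f f) / ipT f g / 2).
  have -> : 2 * (- (1 + ipT f f) / ipT f g / 2) * ipT f g = - (1 + ipT f f).
    by field.
  by rewrite mulr0 => ?; exfalso; lra.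
have gp : 0 < ipT g g by rewrite lt_def g0 ip_ge0.
have := Q (- ipT f g / ipT g g).
rewrite -(pmulr_rge0 _ gp).
have -> : ipT g g * (ipT f f + 2 * (- ipT f g / ipT g g) * ipT f g +
  (- ipT f g / ipT g g) ^+ 2 * ipT g g) = ipT f f * ipT g g - ipT f g ^+ 2.
  by field.
by rewrite subr_ge0.
Qed.


(** Let [p] be the sum of the [(f, h i) h i] and [S] the left-hand side. Then [|p|^2 <= e S], and
    expanding [|e f - p|^2 >= 0] gives [e S <= e^2 |f|^2]. Nothing is divided by the norm of [h i],
    so null [h i] are allowed. *)
Lemma orthogonal_bessel (h : nat -> T -> R) (e : R) f N :
    0 < e -> (forall i, L2T (h i)) -> L2T f ->
    (forall i j, i != j -> ipT (h i) (h j) = 0) ->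
    (forall i, ipT (h i) (h i) <= e) ->
  \sum_(i < N) (ipT f (h i)) ^+ 2 <= e * ipT f f.
Proof.
move=> e0 Lh Lf oh he.
pose S := \sum_(i < N) (ipT f (h i)) ^+ 2.
pose p x := \sum_(i < N) ipT f (h i) * h i x.
have Lp : L2T p by exact: L2_sum.
have fp : ipT f p = S.
  by rewrite ip_sumr//; apply: eq_bigr => i _; rewrite expr2.
have pp : ipT p p <= e * S.
  rewrite ip_suml// mulr_sumr; apply: ler_sum => i _.
  rewrite ip_sumr// (bigD1 i)//= big1 ?addr0 => [|j ji]; last first.
    by rewrite oh ?mulr0// eq_sym.
  rewrite mulrA -expr2 mulrC ler_wpM2r ?sqr_ge0//.
have := ip_ge0 (fun x => e * f x + (-1) * p x).
have Lef := L2Z e Lf; have Lmp := L2Z (-1) Lp.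
rewrite ipDl ?ipDr ?ipZl ?ipZr//; last exact: L2D.
rewrite (ipC p f) fp -/S => H.
have := ip_ge0 f; nra.
Qed.

(** Orthogonality gives [(f, f) = (f, f - g k)], so by Cauchy-Schwarz [|f|^2 <= |f - g k|^2], which
    density makes arbitrarily small. *)
Lemma L2_dense_separating (g : nat -> T -> R) f : (forall k, L2T (g k)) ->
    (forall f, L2T f -> forall e, 0 < e -> exists k, sqnorm mu setT (f \- g k) < e) ->
    L2T f -> (forall k, ipT f (g k) = 0) -> null_on mu setT f.
Proof.
move=> Lg dg Lf fg0; apply: ip_eq0_null => //; apply/eqP.
rewrite eq_le ip_ge0 andbT; apply/ler_addgt0Pr => e e0; rewrite add0r.
have [k ke] := dg _ Lf _ e0.
have Lfg : L2T (fun x => f x + (-1) * g k x) by apply: L2D => //; exact: L2Z.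
have fgE : f \- g k = fun x => f x + (-1) * g k x.
  by apply/funext => x /=; rewrite mulN1r.
have := cauchy_schwarz Lf Lfg.
rewrite {1}ipDr ?ipZr ?fg0//; last exact: L2Z.
rewrite mulr0 addr0 => cs.
move: ke; rewrite /sqnorm fgE => ke.
have := ip_ge0 f; rewrite le_eqVlt => /predU1P[<-|f0]; first exact: ltW.
by apply: ltW; apply: le_lt_trans ke; rewrite -(ler_pM2l f0) -expr2.
Qed.

Lemma L2_indic A : measurable A -> (mu A < +oo)%E -> L2T (\1_A).
Proof.
move=> mA Aoo; split; first exact: measurable_indic.
under eq_integral do rewrite expr2 -[_ * _]/((\1_A \* \1_A) _) -indicI setIid.
by rewrite integral_indic// setIT.
Qed.

Lemma ip_indic A B : measurable A -> measurable B ->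
  ipT (\1_A) (\1_B) = fine (mu (A `&` B)).
Proof.
move=> mA mB; rewrite /ip /Rintegral; congr fine.
under eq_integral do rewrite -[_ * _]/((\1_A \* \1_B) _) -indicI.
by rewrite integral_indic ?setIT//; exact: measurableI.
Qed.

End InnerProduct.

(** * Small partitions and disjoint sets from atomlessness and separability *)

Section Atomless.
Context (d : measure_display) (T : measurableType d) (R : realType)
  (mu : {measure set T -> \bar R}).

Local Notation L2T := (L2 mu setT).
Local Notation ipT := (ip mu setT).

Lemma sqnormB (f g : T -> R) : L2T f -> L2T g ->
  sqnorm mu setT (f \- g) = ipT f f - 2 * ipT f g + ipT g g.
Proof.
move=> Lf Lg; rewrite /sqnorm.
have -> : f \- g = fun x => f x + (-1) * g x.
  by apply/funext => x /=; rewrite mulN1r.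
have Lmg := L2Z (-1) Lg.
rewrite ipDl ?ipDr ?ipZl ?ipZr//; last exact: L2D.
rewrite (ipC mu g f); ring.
Qed.

(** Parallelogram law: the right side minus the left is [|f + h - 2 g|^2]. Two orthogonal functions
    of large norm thus cannot both be close to the same [g]; this is how separability is exploited
    below. *)
Lemma sqnorm_approx_orthogonal (f g h : T -> R) : L2T f -> L2T g -> L2T h ->
  ipT f h = 0 ->
  ipT f f + ipT h h <= 2 * (sqnorm mu setT (f \- g) + sqnorm mu setT (h \- g)).
Proof.
move=> Lf Lg Lh fh; rewrite !sqnormB//.
have Lfh := L2D Lf Lh; have L2g := L2Z (-2) Lg.
have := ip_ge0 mu (fun x => (f x + h x) + (-2) * g x).
rewrite (ipDl Lfh)//; last exact: L2D.
rewrite !(ipDr Lfh L2g)// !ipZl// !ipZr// !(ipDl Lf Lh)// !(ipDr Lf Lh)//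
  (ipC mu g f) (ipC mu g h) (ipC mu h f) fh.
move=> H; rewrite -subr_ge0; apply: (le_trans H).
by rewrite le_eqVlt; apply/predU1P; left; ring.
Qed.

Hypothesis mu_atomless : atomless mu.

(** One of [B] and [A \ B] has at most half the measure of [A], and both have positive measure;
    iterate. *)
Lemma atomless_halving (n : nat) A : measurable A -> (0 < mu A < +oo)%E ->
  exists B, [/\ measurable B, B `<=` A & (0 < mu B <= (fine (mu A) / 2 ^+ n)%:E)%E].
Proof.
elim: n A => [|n IH] A mA /andP[A0 Aoo].
  exists A; split => //; rewrite A0 expr0 divr1 fineK ?lexx//.
  by rewrite ge0_fin_numE.
have [B [mB BA /andP[B0 BltA]]] := mu_atomless mA A0.
have Boo : (mu B < +oo)%E by exact: lt_trans Aoo.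
have mD : measurable (A `\` B) by exact: measurableD.
have Doo : (mu (A `\` B) < +oo)%E.
  by apply: le_lt_trans Aoo; rewrite le_measure ?inE.
have muA : mu A = (mu B + mu (A `\` B))%E.
  rewrite -measureU//; last by rewrite setDE setICA setICr setI0.
  by rewrite setDUK.
have D0 : (0 < mu (A `\` B))%E.
  rewrite lt_def measure_ge0 andbT; apply/eqP => D0.
  by move: BltA; rewrite muA D0 adde0 ltxx.
have fA : fine (mu A) = fine (mu B) + fine (mu (A `\` B)).
  by rewrite muA fineD// ge0_fin_numE.
have [C mC [CA C0 CA2]] : exists2 C, measurable C &
    [/\ C `<=` A, (0 < mu C < +oo)%E & fine (mu C) <= fine (mu A) / 2].
  have [BD|DB] := leP (fine (mu B)) (fine (mu (A `\` B))).
    by exists B => //; split => //; [rewrite B0|lra].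
  by exists (A `\` B) => //; split => //; [rewrite D0|lra].
have [B' [mB' B'C /andP[B'0 B'C2]]] := IH _ mC C0.
exists B'; split => //; first exact: subset_trans CA.
rewrite B'0 (le_trans B'C2)// lee_fin exprS invfM mulrA.
by rewrite ler_wpM2r// invr_ge0 exprn_ge0.
Qed.

(** One use of atomlessness yields [B] of finite measure even when [mu A] is infinite; halving [B]
    at least [mu B / e] times suffices, as [n < 2 ^ n]. *)
Lemma atomless_small (e : R) A : 0 < e -> measurable A -> (0 < mu A)%E ->
  exists B, [/\ measurable B, B `<=` A & (0 < mu B <= e%:E)%E].
Proof.
move=> e0 mA A0; have [B [mB BA /andP[B0 BltA]]] := mu_atomless mA A0.
have Boo : (mu B < +oo)%E by apply: (lt_le_trans BltA); rewrite leey.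
pose n := Num.bound (fine (mu B) / e).
have [|C [mC CB /andP[C0 CB2]]] := atomless_halving n mB; first by rewrite B0.
exists C; split => //; first exact: subset_trans BA.
rewrite C0 (le_trans CB2)// lee_fin ler_pdivrMr ?exprn_gt0//.
rewrite mulrC -ler_pdivrMr//.
have h0 : 0 <= fine (mu B) / e by rewrite divr_ge0 ?fine_ge0// ltW.
apply: (le_trans (ltW (archi_boundP h0))); rewrite -/n -natrX ler_nat.
exact/ltnW/ltn_expl.
Qed.

Hypothesis mu_separable : L2_separable mu.

(** For each [(k, j)] choose one small set whose indicator is within [1 / (j + 1)] of [g k], if
    there is any. Were the union of these sets to miss a set of positive measure, a small [C] inside
    the missed set would be close to some [g k], and so would the set chosen for that pair; the two
    are disjoint, contradicting [sqnorm_approx_orthogonal]. *)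
Lemma small_partition (e : R) : 0 < e -> exists A : nat -> set T,
  [/\ forall n, measurable (A n), forall n, (mu (A n) <= e%:E)%E,
      trivIset setT A & {ae mu, forall x, exists n, A n x}].
Proof.
move=> e0; have [g [Lg dg]] := mu_separable.
pose small B := measurable B /\ (mu B <= e%:E)%E.
pose near (p : nat * nat) B :=
  sqnorm mu setT (\1_B \- g p.1) < p.2.+1%:R^-1.
have /choice[B0 B0P] p : exists B, small B /\
    ((exists B', small B' /\ near p B') -> near p B).
  have [[B [sB nB]]|nB] := pselect (exists B', small B' /\ near p B').
    by exists B; split.
  by exists set0; split => //; split; rewrite ?measure0 ?lee_fin ?ltW.
(* Codes that decode to no pair fall back on [(0, 0)], which only repeats a set. *)
pose B n := B0 (odflt (0, 0)%N (unpickle n)).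
have mB n : measurable (B n) by have [[]] := B0P (odflt (0, 0)%N (unpickle n)).
have Be n : (mu (B n) <= e%:E)%E by have [[]] := B0P (odflt (0, 0)%N (unpickle n)).
have mN : measurable (~` \bigcup_n B n).
  exact/measurableC/bigcup_measurable.
have N0 : mu (~` \bigcup_n B n) = 0.
  apply/eqP; rewrite -[_ == _]negbK; apply/negP => N0.
  have {}N0 : (0 < mu (~` \bigcup_n B n))%E by rewrite lt_def N0 measure_ge0.
  have [C [mC CN /andP[C0 Ce]]] := atomless_small e0 mN N0.
  have Coo : (mu C < +oo)%E by apply: le_lt_trans Ce _; rewrite ltry.
  have c0 : 0 < fine (mu C) by rewrite fine_gt0// C0.
  (* The contradiction will read [mu C <= 4 / (j + 1)]; the factor 8 leaves room. *)
  pose j := Num.bound (8 / fine (mu C)).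
  have jc : 8 * j.+1%:R^-1 < fine (mu C).
    rewrite ltr_pdivrMr// mulrC -ltr_pdivrMr//.
    have h0 : 0 <= 8 / fine (mu C) by rewrite divr_ge0// ltW.
    by apply: lt_le_trans (archi_boundP h0) _; rewrite ler_nat.
  have LC : L2T (\1_C) by exact: L2_indic.
  have j0 : 0 < j.+1%:R^-1 :> R by rewrite invr_gt0.
  have [k kC] := dg _ LC _ j0.
  have [[mB1 B1e] /(_ _)nB1] := B0P (k, j).
  have {}nB1 : near (k, j) (B0 (k, j)) by apply: nB1; exists C.
  have LB1 : L2T (\1_(B0 (k, j))).
    by apply: L2_indic => //; apply: le_lt_trans B1e _; rewrite ltry.
  have CB1 : C `&` B0 (k, j) = set0.
    apply/seteqP; split => // x [/CN Cx Bx]; apply: Cx.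
    by exists (pickle (k, j)) => //; rewrite /B pickleK.
  have := sqnorm_approx_orthogonal LC (Lg k) LB1.
  rewrite !ip_indic// CB1 measure0 setIid => /(_ erefl).
  have := fine_ge0 (measure_ge0 mu (B0 (k, j) `&` B0 (k, j))).
  move: nB1 kC jc; rewrite /near /=; set q := _^-1 => nB1 kC jc ? ?; lra.
have mD n : measurable (seqDU B n).
  by apply: measurableD => //; exact: bigsetU_measurable.
exists (seqDU B); split => //.
- by move=> n; apply: le_trans (Be n); rewrite le_measure ?inE//; exact: subset_seqDU.
- exists (~` \bigcup_n B n); split => // x /= nx [n _ Bnx]; apply: nx.
  have : (\bigcup_n B n) x by exists n.
  by rewrite seqDU_bigcup_eq => -[m _ ?]; exists m.
Qed.

(** Repeatedly remove from the remainder [Q n] a subset [f (Q n)] of strictly smaller measure: the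
    removed set has finite measure and the new remainder keeps positive measure. *)
Lemma disjoint_positive : (0 < mu setT)%E -> exists A : nat -> set T,
  [/\ forall n, measurable (A n), forall n, (0 < mu (A n) < +oo)%E &
      forall i j, i != j -> A i `&` A j = set0].
Proof.
move=> mu0.
have /choice[f fP] A : exists B, measurable A -> (0 < mu A)%E ->
    [/\ measurable B, B `<=` A & (0 < mu B < mu A)%E].
  have [[mA A0]|nA] := pselect (measurable A /\ (0 < mu A)%E).
    by have [B BP] := mu_atomless mA A0; exists B.
  by exists set0 => mA A0; exfalso; exact: nA.
pose Q n := iter n (fun A => A `\` f A) setT.
have QP n : measurable (Q n) /\ (0 < mu (Q n))%E.
  elim: n => [|n [mQ Q0]] //=; have [mf fQ /andP[f0 fltQ]] := fP _ mQ Q0.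
  split; first exact: measurableD.
  rewrite lt_def measure_ge0 andbT; apply/eqP => D0.
  have := measureU mu mf (measurableD mQ mf).
  rewrite setDE setICA setICr setI0 -setDE setDUK// => /(_ erefl) E.
  by move: fltQ; rewrite E [X in (_ + X)%E]D0 adde0 ltxx.
have fQP n := fP _ (QP n).1 (QP n).2.
have Qdec m n : (m <= n)%N -> Q n `<=` Q m.
  elim: n => [|n IH]; first by rewrite leqn0 => /eqP->.
  rewrite leq_eqVlt => /predU1P[->//|]; rewrite ltnS => /IH H.
  by apply: subset_trans H => x [].
have disj i j : (i < j)%N -> f (Q i) `&` f (Q j) = set0.
  move=> ij; apply/seteqP; split => // x [fi fj].
  have [_ /(_ _ fj) + _] := fQP j; move=> /(Qdec _ _ ij) [_]; exact.
exists (fun n => f (Q n)); split.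
- by move=> n; have [] := fQP n.
- move=> n; have [_ _ /andP[-> /lt_le_trans->//]] := fQP n.
  by rewrite leey.
- move=> i j; rewrite neq_ltn => /orP[|] /disj//.
  by rewrite setIC.
Qed.

End Atomless.

(** * Bessel sequences of nonnegative functions with divergent sum of squares *)

Section BesselSequences.
Context (d : measure_display) (T : measurableType d) (R : realType)
  (mu : {measure set T -> \bar R}).

Local Notation L2T := (L2 mu setT).
Local Notation ipT := (ip mu setT).

Definition bessel_bound (b : R) (h : nat -> T -> R) :=
  forall f, L2T f -> (bessel_sum mu setT f h <= (b * ipT f f)%:E)%E.

(** The terms are nonnegative, so both sides are the same unordered sum over pairs. *)
Lemma nneseries_pair (a : nat -> nat -> \bar R) (phi : nat -> nat * nat) :
    (forall m n, 0 <= a m n)%E -> bijective phi ->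
  (\sum_(0 <= i <oo) a (phi i).1 (phi i).2 =
   \sum_(0 <= m <oo) \sum_(0 <= n <oo) a m n)%E.
Proof.
move=> a0 bphi.
rewrite [RHS]nneseries_esumT; last by move=> m; exact: nneseries_ge0.
under [RHS]eq_esum do rewrite nneseries_esumT//.
rewrite esum_esum// [LHS]nneseries_esumT//.
have -> : setT `*`` (fun=> setT) = [set: nat * nat] by apply/seteqP; split.
rewrite (@reindex_esum _ _ _ [set: nat] _ phi)//.
by rewrite setTT_bijective.
Qed.

Lemma bessel_sum_le (f : T -> R) (h : nat -> T -> R) (c : R) :
  (forall N, \sum_(i < N) (ipT f (h i)) ^+ 2 <= c) ->
  (bessel_sum mu setT f h <= c%:E)%E.
Proof.
move=> H; apply: lime_le.
  by apply: is_cvg_nneseries => n _ _; rewrite lee_fin sqr_ge0.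
by apply: nearW => n; rewrite sumEFin lee_fin big_mkord.
Qed.

Lemma scaled_bessel_bound (b : R) (g : nat -> T -> R) : 0 < b ->
    (forall k, L2T (g k)) ->
  exists c : nat -> R, (forall k, 0 < c k) /\
    bessel_bound b (fun k x => c k * g k x).
Proof.
move=> b0 Lg.
(* By Cauchy-Schwarz the [k]-th term is at most [b 2^-(k+1) |f|^2], and these sum to [b |f|^2]. The
   added 1 guards against a null [g k]. *)
pose q k := b / 2 ^+ k.+1 / (1 + ipT (g k) (g k)).
have gp k : 0 < 1 + ipT (g k) (g k) by rewrite ltr_wpDr// ip_ge0.
have q0 k : 0 < q k by rewrite divr_gt0// divr_gt0// exprn_gt0.
exists (fun k => Num.sqrt (q k)); split=> [k|f Lf]; first by rewrite sqrtr_gt0.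
have bf : 0 <= b * ipT f f by rewrite mulr_ge0 ?ip_ge0// ltW.
apply: le_trans (epsilon_trick0 xpredT bf).
apply: lee_nneseries => [k _ _|k _]; rewrite lee_fin ?sqr_ge0//.
rewrite ipZr// exprMn sqr_sqrtr; last exact: ltW.
apply: (@le_trans _ _ (q k * (ipT f f * ipT (g k) (g k)))).
  by rewrite ler_wpM2l ?cauchy_schwarz// ltW.
have -> : b * ipT f f / (2 ^ k.+1)%:R =
          q k * (ipT f f * (1 + ipT (g k) (g k))).
  by rewrite natrX /q; field; rewrite gt_eqF//= expf_neq0.
apply: ler_wpM2l; first exact: ltW.
by apply: ler_wpM2l; [exact: ip_ge0|lra].
Qed.

Lemma indic_bessel_bound (e : R) (A : nat -> set T) : 0 < e ->
  (forall n, measurable (A n)) -> (forall n, (mu (A n) <= e%:E)%E) ->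
  trivIset setT A -> bessel_bound e (fun n => \1_(A n)).
Proof.
move=> e0 mA Ae tA f Lf; apply: bessel_sum_le => N.
have Aoo n : (mu (A n) < +oo)%E by apply: le_lt_trans (Ae n) _; rewrite ltry.
apply: (@orthogonal_bessel _ _ _ mu (fun n => \1_(A n))) => // [i|i j ij|i].
- exact: L2_indic.
- rewrite ip_indic//; move/trivIsetP : tA => /(_ i j I I ij) ->.
  by rewrite measure0.
- by rewrite ip_indic// setIid -lee_fin fineK// ge0_fin_numE.
Qed.

Lemma nneseries_ge_term (a : nat -> \bar R) n : (forall k, 0 <= a k)%E ->
  (a n <= \sum_(0 <= k <oo) a k)%E.
Proof.
move=> a0; rewrite (@nneseriesD1 _ _ n xpredT)// leeDl// nneseries_ge0//.
Qed.

Hypothesis mu_atomless : atomless mu.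
Hypothesis mu_separable : L2_separable mu.

(** The sequence is a doubly indexed family flattened by a bijection: row [m] has Bessel bound
    [e m], and these bounds sum to 1/2. Rows 0 and 1 give completeness, the others divergence. *)
Lemma divergent_bessel : exists v : nat -> T -> R,
  [/\ forall n, L2T (v n), forall n x, 0 <= v n x,
      {ae mu, forall x, (\sum_(0 <= n <oo) ((v n x) ^+ 2)%:E)%E = +oo%E},
      bessel_bound (2^-1) v &
      forall f, L2T f -> (forall n, ipT f (v n) = 0) -> null_on mu setT f].
Proof.
have [g [Lg dg]] := mu_separable.
pose e m : R := 2^-1 / 2 ^+ m.+1.
have e0 m : 0 < e m by rewrite divr_gt0 ?invr_gt0// exprn_gt0.
have Lgp k : L2T (g k)^\+.
  apply: le_L2 (Lg k); first by apply: measurable_funrpos; case: (Lg k).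
  move=> x; rewrite /funrpos ger0_norm ?le_max ?lexx ?orbT//.
  by rewrite ge_max ler_norm normr_ge0.
have Lgn k : L2T (g k)^\-.
  apply: le_L2 (Lg k); first by apply: measurable_funrneg; case: (Lg k).
  move=> x; rewrite /funrneg ger0_norm ?le_max ?lexx ?orbT//.
  by rewrite ge_max -normrN ler_norm normr_ge0.
have [cp [cp0 bp]] := scaled_bessel_bound (e0 0%N) Lgp.
have [cn [cn0 bn]] := scaled_bessel_bound (e0 1%N) Lgn.
have /choice[A AP] := fun m => small_partition mu_atomless mu_separable (e0 m.+2).
have mA m n : measurable (A m n) by have [] := AP m.
have Ae m n : (mu (A m n) <= (e m.+2)%:E)%E by have [] := AP m.
(* Splitting [g k] into its two parts keeps every function nonnegative; orthogonality to both parts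
   gives orthogonality to [g k]. *)
pose h m := match m with
  | 0 => fun k x => cp k * (g k)^\+ x
  | 1 => fun k x => cn k * (g k)^\- x
  | m.+2 => fun n => \1_(A m n)
  end.
have Lh m n : L2T (h m n).
  move: m => [|[|m]] /=; [exact: L2Z|exact: L2Z|].
  by apply: L2_indic => //; apply: le_lt_trans (Ae m n) _; rewrite ltry.
have h0 m n x : 0 <= h m n x.
  move: m => [|[|m]] /=.
  - by rewrite mulr_ge0// ltW.
  - by rewrite mulr_ge0// ltW.
  - by [].
have bh m : bessel_bound (e m) (h m).
  move: m => [|[|m]] //=; have [_ _ tA _] := AP m.
  exact: indic_bessel_bound.
have /card_esym/card_set_bijP[phi phib] := card_nat2.
rewrite setTT_bijective in phib.
have [psi phiK psiK] := phib.
exists (fun i => h (phi i).1 (phi i).2); split => //.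
- have /ae_foralln : forall m, {ae mu, forall x, exists n, A m n x}.
    by move=> m; have [] := AP m.
  apply: filterS => x Ax.
  rewrite (@nneseries_pair (fun m n => ((h m n x) ^+ 2)%:E))//; last first.
    by move=> m n; rewrite lee_fin sqr_ge0.
  have row m : (1 <= \sum_(0 <= n <oo) ((h m.+2 n x) ^+ 2)%:E)%E.
    have [n Anx] := Ax m.
    apply: (@le_trans _ _ ((h m.+2 n x) ^+ 2)%:E).
      by rewrite /= indicE mem_set// expr1n.
    by apply: (@nneseries_ge_term (fun n => ((h m.+2 n x) ^+ 2)%:E)) => k;
      rewrite lee_fin sqr_ge0.
  have row0 m : (0 <= \sum_(0 <= n <oo) ((h m n x) ^+ 2)%:E)%E.
    by apply: nneseries_ge0 => n _ _; rewrite lee_fin sqr_ge0.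
  (* Rows 0 and 1 are dropped; the next [N >= |r|] rows contribute at least 1 each. *)
  apply/eq_infty => r; pose N := Num.bound `|r|.
  apply: le_trans (nneseries_lim_ge N.+2 _); last by move=> m _ _; exact: row0.
  rewrite big_nat_recl// big_nat_recl//= addeA.
  apply: (@le_trans _ _ (\sum_(0 <= i < N) 1%:E)%E).
    rewrite sumEFin lee_fin big_const_nat subn0 iter_addr_0.
    by apply: le_trans (ler_norm r) _; exact/ltW/archi_boundP.
  apply: (@le_trans _ _ (\sum_(0 <= i < N)
      \sum_(0 <= n <oo) ((h i.+2 n x) ^+ 2)%:E)%E).
    by apply: lee_sum => m _; exact: row.
  by rewrite leeDr// adde_ge0//; [exact: (row0 0%N)|exact: (row0 1%N)].
- move=> f Lf; rewrite /bessel_sum.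
  rewrite (@nneseries_pair (fun m n => ((ipT f (h m n)) ^+ 2)%:E))//; last first.
    by move=> m n; rewrite lee_fin sqr_ge0.
  have ff0 : 0 <= 2^-1 * ipT f f by rewrite mulr_ge0 ?ip_ge0.
  apply: le_trans (epsilon_trick0 xpredT ff0).
  apply: lee_nneseries => [m _ _|m _].
    by apply: nneseries_ge0 => n _ _; rewrite lee_fin sqr_ge0.
  apply: le_trans (bh m f Lf) _.
  by rewrite lee_fin /e natrX mulrAC.
- move=> f Lf fv.
  have fh m n : ipT f (h m n) = 0 by have := fv (psi (m, n)); rewrite psiK.
  apply: (L2_dense_separating Lg dg) => // k.
  have -> : g k = fun x => (g k)^\+ x + (-1) * (g k)^\- x.
    apply/funext => x; rewrite mulN1r.
    by rewrite -[in LHS](funrposBneg (g k)).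
  rewrite ipDr ?ipZr//; last exact: L2Z.
  have /eqP := fh 0%N k; have /eqP := fh 1%N k; rewrite /= !ipZr//.
  rewrite !mulf_eq0 (gt_eqF (cp0 k)) (gt_eqF (cn0 k)) => /eqP-> /eqP->.
  by rewrite mulr0 addr0.
Qed.

End BesselSequences.

(** * Cholesky factorization of infinite positive semidefinite kernels *)

Section Cholesky.
Context (R : rcfType).
Implicit Types (K : nat -> nat -> R) (c : nat -> R).

Definition quad K N c := \sum_(i < N) \sum_(j < N) c i * c j * K i j.

Definition psd_kernel K :=
  (forall i j, K i j = K j i) /\ forall N c, 0 <= quad K N c.

Definition schur K k i j := K i j - K i k * K k j / K k k.

Lemma sum_single N k (F : nat -> R) : (k < N)%N ->
  \sum_(i < N) (i == k :> nat)%:R * F i = F k.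
Proof.
move=> kN; rewrite (bigD1 (Ordinal kN))//= eqxx mul1r big1 ?addr0// => i ik.
have -> : (i == k :> nat) = false by apply/negbTE; move: ik; rewrite -val_eqE.
by rewrite mul0r.
Qed.

Lemma quad_add_single K N c a k : (forall i j, K i j = K j i) -> (k < N)%N ->
  quad K N (fun i => c i + a * (i == k)%:R) =
  quad K N c + 2 * a * (\sum_(i < N) c i * K i k) + a ^+ 2 * K k k.
Proof.
move=> sK kN.
have -> : quad K N (fun i => c i + a * (i == k)%:R) =
  \sum_(i < N) (\sum_(j < N) c i * c j * K i j + a * (c i * K i k)
    + a * ((i == k :> nat)%:R * \sum_(j < N) c j * K i j)
    + a ^+ 2 * ((i == k :> nat)%:R * K i k)).
  apply: eq_bigr => i _.
  rewrite -[X in a * (c i * X)](@sum_single N k (K i))//.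
  rewrite -[X in a ^+ 2 * (_ * X)](@sum_single N k (K i))//.
  rewrite !mulr_sumr -!big_split /=; apply: eq_bigr => j _; ring.
rewrite !big_split /= -!mulr_sumr.
rewrite (@sum_single N k (fun i => \sum_(j < N) c j * K i j))//.
rewrite (@sum_single N k (fun i => K i k))//.
rewrite /quad.
have -> : \sum_(j < N) c j * K k j = \sum_(i < N) c i * K i k.
  by apply: eq_bigr => j _; rewrite sK.
ring.
Qed.

Lemma quad0 K N : quad K N (fun=> 0) = 0.
Proof. by rewrite /quad big1// => i _; rewrite big1// => j _; rewrite !mul0r. Qed.

(** Padding [c] with zeros does not change the form, so one may assume that coordinate [k] is in
    range, as the Schur complement argument requires. *)
Lemma psd_kernel_large K k : (forall i j, K i j = K j i) ->
  (forall N c, (k < N)%N -> 0 <= quad K N c) -> psd_kernel K.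
Proof.
move=> sK H; split => // N c.
have trunc (F : nat -> R) : \sum_(i < N) F i =
    \sum_(i < maxn N k.+1) (if (i < N)%N then F i else 0).
  by rewrite (big_ord_widen (maxn N k.+1) F) ?leq_maxl// big_mkcond.
have := H (maxn N k.+1) (fun i => if (i < N)%N then c i else 0) (leq_maxr _ _).
congr (_ <= _); rewrite /quad (trunc (fun i => \sum_(j < N) c i * c j * K i j)).
apply: eq_bigr => i _; case: ifP => iN; last first.
  by rewrite big1// => j _; rewrite !mul0r.
rewrite (trunc (fun j => c i * c j * K i j)); apply: eq_bigr => j _.
by case: ifP => //; rewrite mulr0 mul0r.
Qed.

Lemma psd_kernel_diag K k : psd_kernel K -> 0 <= K k k.
Proof.
(* The [k]-th unit vector, written as a perturbation of 0 so that [quad_add_single] applies. *)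
move=> [sK pK]; have := pK k.+1 (fun i => 0 + 1 * (i == k)%:R).
rewrite quad_add_single// quad0 big1 => [|i _]; last by rewrite mul0r.
by rewrite mulr0 !add0r expr1n mul1r.
Qed.

(** On [e_j + a e_k] the form equals [K j j + 2 a K j k], affine in [a] and never negative, so its
    slope is 0. *)
Lemma psd_kernel_eq0 K k j : psd_kernel K -> K k k = 0 -> K k j = 0.
Proof.
move=> pK K0; have Kjj := psd_kernel_diag j pK; case: pK => sK pK.
have Q a : 0 <= K j j + 2 * a * K j k.
  have := pK (maxn j k).+1 (fun i => (0 + 1 * (i == j)%:R) + a * (i == k)%:R).
  rewrite quad_add_single// ?ltnS ?leq_maxr// quad_add_single// ?ltnS ?leq_maxl//.
  rewrite quad0 big1 => [|i _]; last by rewrite mul0r.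
  under eq_bigr do rewrite add0r mul1r.
  rewrite (@sum_single _ j (fun i => K i k)) ?ltnS ?leq_maxl// K0; congr (_ <= _); ring.
rewrite sK; apply/eqP; apply: contraT => Kjk.
have := Q (- (1 + K j j) / K j k / 2).
have -> : 2 * (- (1 + K j j) / K j k / 2) * K j k = - (1 + K j j) by field.
lra.
Qed.

(* The Schur complement evaluates the form at the minimizer over the k-th
   coordinate; when [K k k = 0], the junk value [x / 0 = 0] makes [schur K k]
   equal to [K]. *)
Lemma psd_schur K k : psd_kernel K -> psd_kernel (schur K k).
Proof.
move=> pK; have [K0|K0] := eqVneq (K k k) 0.
  have -> // : schur K k = K.
  by apply/funext => i; apply/funext => j; rewrite /schur K0 invr0 mulr0 subr0.
case: pK => sK pK; apply: (@psd_kernel_large _ k) => [i j|N c kN].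
  by rewrite /schur sK (sK i k) (sK k j) (mulrC (K k i)).
pose S := \sum_(i < N) c i * K i k.
have := pK N (fun i => c i + (- S / K k k) * (i == k)%:R).
rewrite quad_add_single// -/S.
have -> : quad (schur K k) N c = quad K N c - S ^+ 2 / K k k.
  rewrite /quad expr2 {1}/S !mulr_suml -sumrB; apply: eq_bigr => i _.
  rewrite /S mulr_sumr mulr_suml -sumrB; apply: eq_bigr => j _.
  rewrite /schur (sK k j); ring.
by congr (_ <= _); field.
Qed.

(** Symmetric Gaussian elimination with pivots 0, ..., n-1. Eliminated rows stay in place as zero
    rows, so indices never shift. *)
Fixpoint schur_iter K n := if n is m.+1 then schur (schur_iter K m) m else K.

Lemma psd_schur_iter K n : psd_kernel K -> psd_kernel (schur_iter K n).
Proof. by move=> pK; elim: n => //= n; exact: psd_schur. Qed.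

(** Stage [n] clears row [n]; if its pivot is 0, positivity has already made the row zero. Later
    stages preserve zero rows. *)
Lemma schur_iter_eq0 K n i j : psd_kernel K -> (i < n)%N ->
  schur_iter K n i j = 0.
Proof.
move=> pK; elim: n i j => // n IH i j; rewrite ltnS leq_eqVlt /= => /predU1P[->|lin].
  have pS := psd_schur_iter n pK; rewrite /schur.
  have [S0|S0] := eqVneq (schur_iter K n n n) 0.
    by rewrite (psd_kernel_eq0 j pS S0) mulr0 mul0r subrr.
  by rewrite mulrAC divff// mul1r subrr.
by rewrite /schur (IH i j lin) (IH i n lin) !mul0r subrr.
Qed.

(** Column [k] of [L] is the square root of the rank-one term removed at stage [k], so the sum
    telescopes to [K] minus the remainder [S N], whose row [i] vanishes for [i < N]. A zero pivot
    gives a zero column, since [x / 0 = 0]. *)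
Lemma cholesky K : psd_kernel K -> exists L : nat -> nat -> R,
  (forall i k, (i < k)%N -> L i k = 0) /\
  (forall i j N, (i < N)%N -> K i j = \sum_(k < N) L i k * L j k).
Proof.
move=> pK; pose S := schur_iter K.
exists (fun i k => S k i k / Num.sqrt (S k k k)); split=> [i k ik|i j N iN].
  by rewrite /S schur_iter_eq0// mul0r.
suff -> : K i j = \sum_(k < N) S k i k / Num.sqrt (S k k k)
    * (S k j k / Num.sqrt (S k k k)) + S N i j.
  by rewrite [S N i j]schur_iter_eq0// addr0.
elim: N {iN} => [|n IH]; first by rewrite big_ord0 add0r.
rewrite big_ord_recr /= {1}IH -addrA; congr (_ + _).
have pS := psd_schur_iter n pK; rewrite -[S n.+1 i j]/(schur (S n) n i j) /schur.
have sS := pS.1; rewrite -/(S n) in sS.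
rewrite (sS n j) mulrACA -invfM -expr2 sqr_sqrtr; first by rewrite addrC subrK.
exact: psd_kernel_diag.
Qed.

End Cholesky.

(** * Extending an orthonormal sequence to a basis with prescribed positions *)

Section BasisExtension.
Context (d : measure_display) (T : measurableType d) (R : realType)
  (mu : {measure set T -> \bar R}).

Local Notation L2T := (L2 mu setT).
Local Notation ipT := (ip mu setT).

(** A set rather than a family, so that Zorn's lemma applies under inclusion. Distinct members are
    never a.e. equal, since their inner product is 0 and not 1. *)
Definition orthonormal_set (S : set (T -> R)) :=
  (forall f, S f -> L2T f) /\
  (forall f g, S f -> S g -> f = g /\ ipT f g = 1 \/ f <> g /\ ipT f g = 0).

Lemma maximal_orthonormal (base : set (T -> R)) : orthonormal_set base ->
  exists S, [/\ base `<=` S, orthonormal_set S &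
    forall f, L2T f -> (forall g, S g -> ipT f g = 0) -> null_on mu setT f].
Proof.
(* Adjoining [base] inside [P] makes the empty chain harmless. *)
move=> ob; pose P S := orthonormal_set (S `|` base).
have [F FP tF|M [PM maxM]] := @Zorn_bigcup _ P.
  have common f g : ((\bigcup_(X in F) X) `|` base) f ->
      ((\bigcup_(X in F) X) `|` base) g ->
      exists S, [/\ orthonormal_set S, S f & S g].
    move=> [[X FX Xf]|bf] [[Y FY Yg]|bg].
    - have [XY|YX] := tF X Y FX FY.
        exists (Y `|` base); split; [exact: FP|by left; exact: XY|by left].
      by exists (X `|` base); split; [exact: FP|left|left; exact: YX].
    - by exists (X `|` base); split; [exact: FP|left|right].
    - by exists (Y `|` base); split; [exact: FP|right|left].
    - by exists base.
  split=> [f Sf|f g Sf Sg].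
    by have [S [[LS _] Sf' _]] := common f f Sf Sf; exact: LS.
  by have [S [[_ oS] Sf' Sg']] := common f g Sf Sg; exact: oS.
exists (M `|` base); split => // f Lf fS; apply: contrapT => nf.
have f0 : 0 < ipT f f.
  rewrite lt_def ip_ge0 andbT; apply/eqP => f0; apply: nf; exact: ip_eq0_null.
(* If completeness failed at [f], its normalization could be added to [M], against maximality. *)
pose s := (Num.sqrt (ipT f f))^-1.
pose h x := s * f x.
have Lh : L2T h by exact: L2Z.
have hh : ipT h h = 1.
  rewrite /h ipZl ?ipZr// mulrA -expr2 /s exprVn sqr_sqrtr; last exact: ltW.
  by rewrite mulVf// gt_eqF.
have hS g : (M `|` base) g -> ipT h g = 0.
  by move=> Sg; rewrite /h ipZl ?fS ?mulr0//; case: PM => + _; exact.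
have nhS : ~ (M `|` base) h.
  by move=> /hS; rewrite hh => /eqP; rewrite oner_eq0.
have [LM oM] := PM.
apply: (maxM (M `|` [set h])).
  split; first by left.
  by move=> /(_ h); apply: contra_not nhS => /(_ (or_intror erefl)); left.
rewrite /P setUAC; split=> [g [/LM//|->//]|g k [Sg|->] [Sk|->]].
- exact: oM.
- right; split; last by rewrite ipC hS.
  by move=> gh; apply: nhS; rewrite -gh.
- right; split; last by rewrite hS.
  by move=> gh; apply: nhS; rewrite gh.
- by left.
Qed.

Hypothesis mu_separable : L2_separable mu.

(** Send each member to the index of a dense function at squared distance below 1/2. Two distinct
    members sharing an index would give [2 < 2] by [sqnorm_approx_orthogonal]. *)
Lemma orthonormal_countable (S : set (T -> R)) : orthonormal_set S -> countable S.
Proof.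
move=> [LS oS]; have [g [Lg dg]] := mu_separable.
have /choice[k kP] f : exists k, S f -> sqnorm mu setT (f \- g k) < 2^-1.
  have [Sf|nS] := pselect (S f); last by exists 0%N.
  by have [|k kf] := dg f (LS _ Sf) (2^-1); [rewrite invr_gt0|exists k].
apply/countable_injP; exists k => f h /set_mem Sf /set_mem Sh kfh.
have [[]//|[_ fh0]] := oS f h Sf Sh.
have n1 f' : S f' -> ipT f' f' = 1.
  by move=> Sf'; have [[]//|[]//] := oS f' f' Sf' Sf'.
have := sqnorm_approx_orthogonal (LS _ Sf) (Lg (k f)) (LS _ Sh) fh0.
have := kP f Sf; have := kP h Sh; rewrite !n1// kfh; set x := sqnorm _ _ _.
set y := sqnorm _ _ _ => ? ? ?; clear kfh; exfalso; lra.
Qed.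

Lemma orthonormal_basis_extension (a b : nat -> T -> R) :
    (forall n, L2T (a n)) -> (forall n, L2T (b n)) ->
    (forall i j, ipT (a i) (a j) = (i == j)%:R) ->
    (forall i j, ipT (b i) (b j) = (i == j)%:R) ->
    (forall i j, ipT (a i) (b j) = 0) ->
  exists u, orthonormal_basis mu u /\ forall n, u (2 * n + 1)%N = a n.
Proof.
move=> La Lb aa bb ab.
have family_inj (w : nat -> T -> R) :
    (forall i j, ipT (w i) (w j) = (i == j)%:R) -> injective w.
  move=> ww i j wij; have := ww i i; rewrite {2}wij ww eqxx.
  by case: eqVneq => // _ /eqP; rewrite eq_sym oner_eq0.
have family (w : nat -> T -> R) i j :
    (forall i j, ipT (w i) (w j) = (i == j)%:R) ->
    w i = w j /\ ipT (w i) (w j) = 1 \/ w i <> w j /\ ipT (w i) (w j) = 0.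
  move=> ww; have [->|ij] := eqVneq i j; first by left; rewrite ww eqxx.
  right; rewrite ww (negbTE ij); split => // /(family_inj _ ww) ji.
  by rewrite ji eqxx in ij.
have nab i j : a i <> b j.
  move=> aibj; have /eqP := ab i j.
  by rewrite -aibj aa eqxx oner_eq0.
have ob : orthonormal_set (range a `|` range b).
  split=> [f [[n _ <-]//|[n _ <-]//]|f g [[i _ <-]|[i _ <-]] [[j _ <-]|[j _ <-]]].
  - exact: family.
  - by right.
  - by right; rewrite ipC; split => // /esym; exact: nab.
  - exact: family.
have [S [bS oS maxS]] := maximal_orthonormal ob.
pose C := S `\` range a.
have cC : countable C.
  apply: sub_countable (orthonormal_countable oS).
  by apply: subset_card_le => f [].
(* This is the role of [b]: its range is infinite, lies in [S] and avoids the range of [a]. *)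
have iC : infinite_set C.
  move=> fC; apply: infinite_nat.
  have fb : finite_set (range b).
    apply: sub_finite_set fC => f [n _ <-]; split; first by apply: bS; right; exists n.
    by move=> [i _ aibn]; exact: nab aibn.
  by rewrite -(eq_finite_set (inj_card_eq (in2W (family_inj _ bb)))).
have /card_esym cardC := eq_card_nat cC iC.
have [c [Cc cinj csurj]] := card_set_bijP cardC.
(* Counting from 0, the odd positions are the even ones of the English statement. *)
pose u k := if odd k then a k./2 else c k./2.
have uodd n : u (2 * n + 1)%N = a n.
  by rewrite /u mul2n addn1 /= odd_double /= uphalf_double.
have ueven n : u (2 * n)%N = c n by rewrite /u mul2n odd_double doubleK.
have uS k : S (u k).
  rewrite /u; case: ifP => _; first by apply: bS; left; exists k./2.
  by have [] := Cc k./2 I.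
have uinj : injective u.
  move=> i j; rewrite /u.
  case: ifP => oi; case: ifP => oj uij.
  - by rewrite -(odd_double_half i) -(odd_double_half j) oi oj
      (family_inj _ aa _ _ uij).
  - by have [_ []] := Cc j./2 I; exists i./2.
  - by have [_ []] := Cc i./2 I; exists j./2.
  - rewrite -(odd_double_half i) -(odd_double_half j) oi oj.
    by rewrite (cinj _ _ (mem_set I) (mem_set I) uij).
have [LS orS] := oS.
exists u; split => //; split; first by move=> k; exact: LS.
split=> [j k|f Lf fu].
  have [[/uinj-> ->]|[ujk ->]] := orS _ _ (uS j) (uS k); first by rewrite eqxx.
  by case: eqVneq ujk => // ->.
apply: maxS => // g Sg.
have [[n _ <-]|ng] := pselect (range a g); first by rewrite -uodd.
by have [|n _ <-] := csurj g; [split|rewrite -ueven].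
Qed.

End BasisExtension.

(** * Orthonormalizing a Bessel sequence by orthogonal corrections *)

Section Dilation.
Context (d : measure_display) (T : measurableType d) (R : realType)
  (mu : {measure set T -> \bar R}).

Local Notation L2T := (L2 mu setT).
Local Notation ipT := (ip mu setT).

(** With [x] the sum of the [c i * v i], the form is [|c|^2 - |x|^2]. Expanding the sum of the
    [(c i - (x, v i))^2] gives [|c|^2 - 2 |x|^2] plus the Bessel sum of [x], which is at most
    [|x|^2]. *)
Lemma gram_complement_psd (v : nat -> T -> R) : (forall n, L2T (v n)) ->
    (forall f N, L2T f -> \sum_(i < N) (ipT f (v i)) ^+ 2 <= ipT f f) ->
  psd_kernel (fun i j => (i == j)%:R - ipT (v i) (v j)).
Proof.
move=> Lv bv; split=> [i j|N c]; first by rewrite eq_sym ipC.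
pose x t := \sum_(i < N) c i * v i t.
have Lx : L2T x by exact: L2_sum.
have -> : quad (fun i j => (i == j)%:R - ipT (v i) (v j)) N c =
    \sum_(i < N) (c i ^+ 2 - c i * ipT x (v i)).
  apply: eq_bigr => i _.
  have -> : c i ^+ 2 = \sum_(j < N) c i * ((j == i :> nat)%:R * c j).
    by rewrite -mulr_sumr (@sum_single _ _ i (fun j => c j)).
  rewrite ip_suml// mulr_sumr -sumrB; apply: eq_bigr => j _.
  rewrite (eq_sym (i : nat)) (ipC _ (v i)).
  by case: eqVneq => [->|_]; rewrite ?mul1r ?mul0r ?mulr1n ?mulr0n; ring.
have xx : \sum_(i < N) c i * ipT x (v i) = ipT x x by rewrite -ip_sumr.
have : 0 <= \sum_(i < N) (c i - ipT x (v i)) ^+ 2.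
  by apply: sumr_ge0 => i _; exact: sqr_ge0.
have -> : \sum_(i < N) (c i - ipT x (v i)) ^+ 2 =
    \sum_(i < N) c i ^+ 2 - 2 * \sum_(i < N) c i * ipT x (v i)
    + \sum_(i < N) (ipT x (v i)) ^+ 2.
  by rewrite mulr_sumr -sumrB -big_split/=; apply: eq_bigr => i _; ring.
have := bv x N Lx.
rewrite sumrB xx; lra.
Qed.

Lemma orthonormal_dilation (v e : nat -> T -> R) : (forall n, L2T (v n)) ->
    (forall f N, L2T f -> \sum_(i < N) (ipT f (v i)) ^+ 2 <= ipT f f) ->
    (forall n, L2T (e n)) -> (forall i j, ipT (e i) (e j) = (i == j)%:R) ->
    (forall i j, ipT (v i) (e j) = 0) ->
  exists L : nat -> nat -> R, forall i j,
    ipT (fun x => v i x + \sum_(k < i.+1) L i k * e k x)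
        (fun x => v j x + \sum_(k < j.+1) L j k * e k x) = (i == j)%:R.
Proof.
move=> Lv bv Le ee ve.
have [L [L0 LK]] := cholesky (gram_complement_psd Lv bv).
(* Both corrections are rewritten as sums up to a common [N]; triangularity of [L] makes the extra
   terms zero. *)
exists L => i j; pose N := (maxn i j).+1.
have widen n : (n < N)%N -> (fun x => \sum_(k < n.+1) L n k * e k x) =
    (fun x => \sum_(k < N) L n k * e k x).
  move=> nN; apply/funext => x.
  rewrite (big_ord_widen N (fun k => L n k * e k x))// big_mkcond.
  apply: eq_bigr => k _; case: ifPn => //; rewrite -leqNgt => /L0 ->.
  by rewrite mul0r.
have iN : (i < N)%N by rewrite ltnS leq_maxl.
have jN : (j < N)%N by rewrite ltnS leq_maxr.
have Lw n : L2T (fun x => \sum_(k < N) L n k * e k x) by exact: L2_sum.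
have vw m n : ipT (v m) (fun x => \sum_(k < N) L n k * e k x) = 0.
  by rewrite ip_sumr// big1// => k _; rewrite ve mulr0.
have wv m n : ipT (fun x => \sum_(k < N) L n k * e k x) (v m) = 0.
  by rewrite ipC vw.
have -> : (fun x => v i x + \sum_(k < i.+1) L i k * e k x) =
    (fun x => v i x + \sum_(k < N) L i k * e k x).
  by apply/funext => x; rewrite -[in RHS](congr1 (@^~ x) (widen _ iN)).
have -> : (fun x => v j x + \sum_(k < j.+1) L j k * e k x) =
    (fun x => v j x + \sum_(k < N) L j k * e k x).
  by apply/funext => x; rewrite -[in RHS](congr1 (@^~ x) (widen _ jN)).
rewrite ipDl//; last exact: L2D.
rewrite !ipDr// vw wv addr0 add0r.
suff -> : ipT (fun x => \sum_(k < N) L i k * e k x)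
    (fun x => \sum_(k < N) L j k * e k x) = (i == j)%:R - ipT (v i) (v j).
  by rewrite addrC subrK.
rewrite (LK i j N iN) ip_suml//; apply: eq_bigr => k _.
rewrite ip_sumr//; congr (_ * _).
under eq_bigr do rewrite ee mulrC eq_sym.
by rewrite (@sum_single _ _ k (L j)).
Qed.

End Dilation.

(** * Passing between [D] and the whole space through extension by zero *)

Section Restriction.
Context (d : measure_display) (T : measurableType d) (R : realType)
  (mu : {measure set T -> \bar R}).

Local Notation L2T := (L2 mu setT).
Local Notation ipT := (ip mu setT).
Implicit Types (D : set T) (f g : T -> R).

Lemma L2_subset D f : measurable D -> L2T f -> L2 mu D f.
Proof.
move=> mD [mf If]; split; first exact: measurable_funTS.
apply: le_lt_trans If; apply: ge0_subset_integral => //.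
  by apply/measurable_EFinP; exact: measurable_funX.
by move=> x _; rewrite lee_fin sqr_ge0.
Qed.

Lemma L2_patch D f : measurable D -> L2 mu D f -> L2T (f \_ D).
Proof.
move=> mD [mf If]; split; first exact/(measurable_restrictT f mD).
apply: le_lt_trans If; rewrite [leRHS]integral_mkcond le_eqVlt; apply/orP; left.
apply/eqP; apply: eq_integral => x _; rewrite !patchE.
by case: ifP => //; rewrite expr0n.
Qed.

Lemma ip_patch D f g : ip mu D f g = ipT (f \_ D) g.
Proof.
rewrite /ip Rintegral_mkcond; apply: eq_Rintegral => x _.
by rewrite !patchE; case: ifP; rewrite ?mul0r.
Qed.

(** Multiplication by an indicator is self-adjoint; this transfers the Bessel bound of a sequence to
    its restriction. *)
Lemma ip_patchC D f g : ipT (f \_ D) g = ipT f (g \_ D).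
Proof.
apply: eq_Rintegral => x _; rewrite !patchE.
by case: ifP; rewrite ?mul0r ?mulr0.
Qed.

Lemma ip_patch_le D f : measurable D -> L2T f ->
  ipT (f \_ D) (f \_ D) <= ipT f f.
Proof.
move=> mD Lf; have LfD : L2T (f \_ D) by apply: L2_patch => //; exact: L2_subset.
apply: le_Rintegral => //; try exact: L2_integrableM.
move=> x _; rewrite patchE; case: ifP => // _.
by rewrite mul0r -expr2 sqr_ge0.
Qed.

Lemma bessel_sum_gt0 D f (v : nat -> T -> R) n : ip mu D f (v n) != 0 ->
  (0 < bessel_sum mu D f v)%E.
Proof.
move=> fv; apply: (@lt_le_trans _ _ ((ip mu D f (v n)) ^+ 2)%:E).
  by rewrite lte_fin lt_def sqr_ge0 sqrf_eq0 fv.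
apply: (@nneseries_ge_term _ (fun n => ((ip mu D f (v n)) ^+ 2)%:E)) => k.
by rewrite lee_fin sqr_ge0.
Qed.

Lemma bessel_bound_finite b (v : nat -> T -> R) f N : bessel_bound mu b v ->
  L2T f -> \sum_(i < N) (ipT f (v i)) ^+ 2 <= b * ipT f f.
Proof.
move=> bv Lf; rewrite -lee_fin; apply: le_trans (bv f Lf).
rewrite -sumEFin -(big_mkord xpredT (fun i => ((ipT f (v i)) ^+ 2)%:E)).
by apply: nneseries_lim_ge => i _ _; rewrite lee_fin sqr_ge0.
Qed.

End Restriction.

Theorem theorem1p2 (d : measure_display) (T : measurableType d) (R : realType)
  (mu : {measure set T -> \bar R}) :
  atomless mu -> (0 < mu setT)%E -> L2_separable mu ->
  (exists v : nat -> T -> R, complete_bessel mu setT v) /\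
  (exists (E : set T) (u : nat -> T -> R),
     [/\ measurable E, (0 < mu E)%E, (mu E < +oo)%E,
         orthonormal_basis mu u &
         complete_bessel mu E (fun n => u (2 * n + 1)%N)]).
Proof.
move=> mu_atomless mu_gt0 mu_sep.
have [v [Lv v0 vdiv vb vsep]] := divergent_bessel mu_atomless mu_sep.
have vpos f : L2 mu setT f -> ~ null_on mu setT f ->
    exists n, ip mu setT f (v n) != 0.
  move=> Lf nf; apply/not_existsP => fv; apply/nf/vsep => // n.
  by apply/eqP/negPn/negP; exact: fv.
split.
  exists v; split => //; split; first by move=> n; exact: aeW.
  split; first by apply: filterS vdiv.
  exists 2^-1; split; first by rewrite invr_gt0.
  by move=> f Lf /(vpos f Lf)[n fn]; split; [exact: bessel_sum_gt0 fn|exact: vb].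
have [A [mA A0 dA]] := disjoint_positive mu_atomless mu_gt0.
have Aoo k : (mu (A k) < +oo)%E by case/andP: (A0 k).
(* The first set serves as [E]; the remaining ones carry the normalized indicators [e k], which
   vanish on [E]. *)
pose E := A 0%N; have mE : measurable E := mA 0%N.
pose V n := v n \_ E.
have LV n : L2 mu setT (V n) by apply: L2_patch => //; exact: L2_subset.
have bV f N : L2 mu setT f ->
    \sum_(i < N) (ip mu setT f (V i)) ^+ 2 <= ip mu setT f f.
  move=> Lf; have LfE : L2 mu setT (f \_ E).
    by apply: L2_patch => //; exact: L2_subset.
  under eq_bigr do rewrite -ip_patchC.
  apply: le_trans (bessel_bound_finite N vb LfE) _.
  have := ip_patch_le mE Lf; have := ip_ge0 mu (f \_ E); lra.
pose s k : R := (Num.sqrt (fine (mu (A k.+1))))^-1.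
pose e k x := s k * \1_(A k.+1) x.
have LA k : L2 mu setT (\1_(A k)) by exact: L2_indic.
have Le k : L2 mu setT (e k) by exact: L2Z.
have ee i j : ip mu setT (e i) (e j) = (i == j)%:R.
  rewrite ipZl// ipZr// ip_indic//; have [->|ij] := eqVneq i j.
    have A0' : 0 < fine (mu (A j.+1)) by rewrite fine_gt0.
    rewrite setIid mulrA -expr2 exprVn sqr_sqrtr ?ltW// mulVf//.
    by rewrite gt_eqF.
  by rewrite dA ?measure0 ?mulr0// eqSS.
have eE k x : E x -> e k x = 0.
  move=> Ex; rewrite /e indicE memNset ?mulr0// => Ax.
  have : (E `&` A k.+1) x by [].
  by rewrite /E dA.
have Ve i j : ip mu setT (V i) (e j) = 0.
  rewrite -ip_patch /ip -[RHS](Rintegral_set0 mu (fun x => v i x * e j x)).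
  rewrite Rintegral_mkcond [RHS]Rintegral_mkcond.
  apply: eq_Rintegral => x _; rewrite !patchE in_set0.
  by case: ifPn => // /set_mem/eE ->; rewrite mulr0.
(* The even-indexed [e] feed the dilation; the odd-indexed ones are kept as the sequence [b] of the
   basis extension. *)
have ee_even i j : ip mu setT (e (2 * i)%N) (e (2 * j)%N) = (i == j)%:R.
  by rewrite ee eqn_pmul2l.
have ee_odd i j : ip mu setT (e (2 * i + 1)%N) (e (2 * j + 1)%N) = (i == j)%:R.
  by rewrite ee eqn_add2r eqn_pmul2l.
have [L aa] := orthonormal_dilation LV bV (fun n => Le (2 * n)%N) ee_even
  (fun i j => Ve i (2 * j)%N).
pose a n x := V n x + \sum_(k < n.+1) L n k * e (2 * k)%N x.
have La n : L2 mu setT (a n).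
  by apply: L2D => //;
    exact: (@L2_sum _ _ _ mu _ _ _ _ (fun k : 'I_n.+1 => e (2 * k)%N)).
have ab i j : ip mu setT (a i) (e (2 * j + 1)%N) = 0.
  rewrite ipDl//; last
    exact: (@L2_sum _ _ _ mu _ _ _ _ (fun k : 'I_i.+1 => e (2 * k)%N)).
  rewrite (@ip_suml _ _ _ mu _ _ _ _ (fun k : 'I_i.+1 => e (2 * k)%N))// Ve add0r.
  rewrite big1// => k _; rewrite ee.
  suff -> : (2 * k == 2 * j + 1)%N = false by rewrite mulr0.
  apply/negP => /eqP /(congr1 odd).
  by rewrite oddD !oddM.
have [u [ou ua]] := orthonormal_basis_extension mu_sep La
  (fun n => Le (2 * n + 1)%N) aa ee_odd ab.
(* The corrections live outside [E], so there the orthonormal [a n] still agrees with [v n]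
   pointwise. *)
have aE n x : E x -> a n x = v n x.
  move=> Ex; rewrite /a big1 => [|k _]; last by rewrite eE// mulr0.
  by rewrite addr0 /V patchE mem_set.
exists E, u; split => //; [by case/andP: (A0 0%N)|exact: Aoo|].
have -> : (fun n => u (2 * n + 1)%N) = a by apply/funext => n; rewrite ua.
split; first by move=> n; exact: L2_subset.
split; first by move=> n; apply: aeW => x Ex; rewrite aE.
split.
  apply: filterS vdiv => x <- Ex; apply: eq_eseriesr => n _.
  by rewrite aE.
(* Testing [a n] against [f] on [E] is testing [v n] against the zero extension of [f], so
   positivity and the bound 1/2, weakened to 1, carry over. *)
exists 1; split => // f Lf nf.
have LfE := L2_patch mE Lf.
have fa n : ip mu E f (a n) = ip mu setT (f \_ E) (v n).
  rewrite -ip_patch; apply: eq_Rintegral => x /set_mem Ex.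
  by rewrite aE.
have [|n fn] := vpos _ LfE.
  move=> nfE; apply: nf; apply: filterS nfE => x + Ex => /(_ I).
  by rewrite patchE mem_set.
split; first by apply: (@bessel_sum_gt0 _ _ _ _ _ _ _ n); rewrite fa.
apply: (@le_trans _ _ (bessel_sum mu setT (f \_ E) v)).
  by rewrite /bessel_sum; under eq_eseriesr do rewrite fa.
apply: le_trans (vb _ LfE) _; rewrite lee_fin mul1r /sqnorm (ip_patch mu E).
have -> : ip mu setT (f \_ E) f = ip mu setT (f \_ E) (f \_ E).
  apply: eq_Rintegral => x _; rewrite patchE.
  by case: ifP => // _; rewrite !mul0r.
have := ip_ge0 mu (f \_ E); lra.
Qed.
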